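(* Let $k,n\ge1$ be integers and let $H_n=(V,\mathcal I)$ be the complete interval hypergraph on $n$ points. At the end of the algorithm $(k,n)$-COLOR$(1,\lceil n/k\rceil,1)$ (described in the context) each $I\in\mathcal I$ is $k$-SCF colored, and the number of used colors is at most $k\left(\left\lfloor\log_2\left\lceil \frac nk\right\rceil\right\rfloor+1\right)$.
   Context: The complete interval hypergraph $H_n=(V,\mathcal I)$ has $V=\{1,\dots,n\}$ and $\mathcal I=\{\{i,i+1,\dots,j\}\mid 1\le i\le j\le n\}$. An interval $I$ is $k$-SCF colored by a coloring $C:V\to\mathbb N$ if: when $|I|\le k$, all points of $I$ have pairwise distinct colors; when $|I|>k$, there are at least $k$ colors each of which is assigned to exactly one point of $I$. Algorithm $(k,n)$-COLOR: let $h=\lceil n/k\rceil$; if $n<hk$, add the points $n+1,\dots,hk$, so that the number of points may be taken to be $hk$. Partition the points into consecutive blocks $B(1),\dots,B(h)$ of $k$ points each, and put $C_t=\{k(t-1)+1,\dots,kt\}$ for $1\le t\le\lfloor\log_2 h\rfloor+1$. The call $(k,n)$-COLOR$(a,b,t)$ with $a\le b$ colors the $k$ points of the median block $B(\lfloor (a+b)/2\rfloor)$ with the $k$ distinct colors of $C_t$, and then recursively colors, using the color sets $C_{t+1},C_{t+2},\dots$ (the same sets on both sides), the blocks $B(a),\dots,B(\lfloor (a+b)/2\rfloor-1)$ and the blocks $B(\lfloor (a+b)/2\rfloor+1),\dots,B(b)$, i.e. it calls itself on these two ranges with parameter $t+1$; a call on an empty range does nothing. *)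

(* Defs.v *)
From mathcomp Require Import all_boot.
From mathcomp Require Import zify.

Set Implicit Arguments.
Unset Strict Implicit.
Unset Printing Implicit Defensive.

(* The point p of {1, ..., n} is the ordinal of value p.-1. *)
Definition interval_hypergraph (n : nat) : {set {set 'I_n}} :=
  [set I | [exists i : 'I_n, [exists j : 'I_n,
     (i <= j) && (I == [set v : 'I_n | i <= v <= j])]]].

Definition used_colors (T : finType) (C : T -> nat) (I : {set T}) : seq nat :=
  undup [seq C v | v in I].

Definition unique_colors (T : finType) (C : T -> nat) (I : {set T}) : seq nat :=
  [seq c <- used_colors C I | #|[set v in I | C v == c]| == 1].

Definition scf_colored (T : finType) (k : nat) (C : T -> nat) (I : {set T}) : Prop :=
  (#|I| <= k -> {in I &, injective C}) /\
  (k < #|I| -> k <= size (unique_colors C I)).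

Definition ceil_div (n k : nat) : nat := (n + k.-1) %/ k.

(* Points, blocks, recursion levels and colors are all numbered from 1. *)
Definition block (k m : nat) : seq nat := iota (k * m.-1).+1 k.
Definition color_set (k t : nat) : seq nat := iota (k * t.-1).+1 k.

(* C' is obtained from C by giving the k points of block m the k colors of
   the t-th color set, in any order. *)
Definition paint (k m t : nat) (C C' : nat -> nat) : Prop :=
  perm_eq [seq C' p | p <- block k m] (color_set k t) /\
  (forall p, p \notin block k m -> C' p = C p).

(* Big-step semantics: color_run k a b t C C' means that the call on the
   blocks a, ..., b with parameter t, started from the coloring C, can end with
   C'. It is a relation because the algorithm does not say which point of a
   block gets which color of the color set. A coloring is total: points not yet
   colored just hold the value of the initial coloring. *)
Inductive color_run (k : nat) :
    nat -> nat -> nat -> (nat -> nat) -> (nat -> nat) -> Prop :=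
| color_run_empty a b t C : b < a -> color_run k a b t C C
| color_run_step a b t C C1 C2 C3 : a <= b ->
    paint k ((a + b) %/ 2) t C C1 ->
    color_run k a ((a + b) %/ 2).-1 t.+1 C1 C2 ->
    color_run k ((a + b) %/ 2).+1 b t.+1 C2 C3 ->
    color_run k a b t C C3.

Lemma paint_exists k m t C : exists C', paint k m t C C'.
Proof.
exists (fun p => if p \in block k m then p - k * m.-1 + k * t.-1 else C p).
split; last by move=> p /negbTE ->.
suff -> : [seq (if p \in block k m then p - k * m.-1 + k * t.-1 else C p)
            | p <- block k m] = color_set k t by [].
apply: (@eq_from_nth _ 0); first by rewrite size_map !size_iota.
rewrite size_map size_iota => i ltik.
rewrite (nth_map 0) ?size_iota // !nth_iota // mem_iota.
by case: ifP; lia.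
Qed.

(* The algorithm terminates: every call on positive block numbers has an
   outcome. *)
Lemma color_run_exists k a b t C :
  0 < a -> exists C', color_run k a b t C C'.
Proof.
have [s] := ubnP (b.+1 - a).
elim: s a b t C => // s IH a b t C les a_gt0.
have [ltba | leab] := ltnP b a; first by exists C; apply: color_run_empty.
have [C1 paint1] := paint_exists k ((a + b) %/ 2) t C.
have [C2 run2] : exists C2, color_run k a ((a + b) %/ 2).-1 t.+1 C1 C2.
  by apply: IH; lia.
have [C3 run3] : exists C3, color_run k ((a + b) %/ 2).+1 b t.+1 C2 C3.
  by apply: IH; lia.
by exists C3; apply: (color_run_step leab paint1 run2 run3).
Qed.

(* Main.v *)
(* Call a color of a list a singleton if it occurs exactly once in it. Induction
   on the recursion shows that every interval of s points has at least min(s, k)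
   singleton colors; for s <= k this says that its colors are distinct. If the
   interval meets the median block, it is L ++ M ++ R with M inside the block.
   The colors of M are distinct and occur neither in L nor in R, as deeper calls
   only use larger colors. If M is the whole block, it gives k singletons.
   Otherwise L or R is empty, and the singletons of the remaining part, bounded
   by induction, add up with those of M. *)
Require Import Defs.
From mathcomp Require Import all_boot.
From mathcomp Require Import zify.

Set Implicit Arguments.
Unset Strict Implicit.
Unset Printing Implicit Defensive.

(** Occurrences are counted, yet a counted color contributes just once because it occurs once; in
    this form the count splits over concatenation. *)
Definition nb_singletons (T : eqType) (s : seq T) : nat :=
  count (fun c => count_mem c s == 1) s.

Lemma perm_nb_singletons (T : eqType) (s1 s2 : seq T) :
  perm_eq s1 s2 -> nb_singletons s1 = nb_singletons s2.
Proof.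
move=> eq12; rewrite /nb_singletons (permP eq12).
by apply: eq_count => c; rewrite (permP eq12).
Qed.

Lemma nb_singletons_cat (T : eqType) (s1 s2 : seq T) :
  ~~ has [in s1] s2 ->
  nb_singletons (s1 ++ s2) = nb_singletons s1 + nb_singletons s2.
Proof.
move=> /hasPn dis12; rewrite /nb_singletons count_cat; congr (_ + _);
  apply: eq_in_count => c cs; rewrite count_cat.
- by rewrite (count_memPn (_ : c \notin s2)) ?addn0 //; apply: contraL cs => /dis12.
- by rewrite (count_memPn (dis12 _ cs)).
Qed.

Lemma nb_singletons_uniq (T : eqType) (s : seq T) :
  uniq s -> nb_singletons s = size s.
Proof.
move=> us; apply/eqP; rewrite -all_count; apply/allP => c cs.
by rewrite count_uniq_mem // cs.
Qed.

Lemma uniq_nb_singletons (T : eqType) (s : seq T) :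
  size s <= nb_singletons s -> uniq s.
Proof.
move=> le_s; have : all (fun c => count_mem c s == 1) s.
  by rewrite all_count eqn_leq count_size.
move=> /allP s1; apply/count_mem_uniq => c.
by have [/s1/eqP // | /count_memPn] := boolP (c \in s).
Qed.

Lemma size_filter_undup_singletons (T : eqType) (s : seq T) :
  size [seq c <- undup s | count_mem c s == 1] = nb_singletons s.
Proof.
rewrite filter_undup undup_id ?size_filter //.
apply/count_mem_uniq => c; rewrite count_filter mem_filter.
have [c1 | cN1] := boolP (count_mem c s == 1).
  have -> : c \in s by rewrite -has_pred1 has_count (eqP c1).
  rewrite -[RHS](eqP c1); apply: eq_count => d /=.
  by case: eqP => // ->; rewrite c1.
by rewrite (@eq_count _ _ pred0) ?count_pred0 // => d /=; case: eqP => // ->; apply: negbTE.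
Qed.

Lemma size_unique_colors (T : finType) (C : T -> nat) (I : {set T}) :
  size (unique_colors C I) = nb_singletons [seq C v | v in I].
Proof.
rewrite -size_filter_undup_singletons; congr size; apply: eq_filter => c.
congr (_ == 1); rewrite count_map cardE -size_filter.
apply/perm_size/uniq_perm => [||v]; first exact: enum_uniq.
  exact/filter_uniq/enum_uniq.
by rewrite mem_enum mem_filter mem_enum inE andbC.
Qed.

(** One inequality covers both clauses: the minimum is [#|I|] for small intervals, which makes every
    entry a singleton, and [k] for large ones. *)
Lemma scf_colored_nb_singletons (T : finType) k (C : T -> nat) (I : {set T}) :
  minn #|I| k <= nb_singletons [seq C v | v in I] -> scf_colored k C I.
Proof.
move=> le_nb; split=> [leIk | ltkI]; last first.
  by rewrite size_unique_colors; apply: leq_trans le_nb; lia.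
apply/dinjectiveP/uniq_nb_singletons; rewrite size_map -cardE.
by apply: leq_trans le_nb; lia.
Qed.

Lemma mem_block k m p : 0 < m -> (p \in block k m) = (k * m.-1 < p <= k * m).
Proof. by case: m => // m _; rewrite mem_iota mulnS /=; lia. Qed.

Lemma paint_color k m t C C' p : paint k m t C C' -> 0 < m -> 0 < t ->
  k * m.-1 < p <= k * m -> k * t.-1 < C' p <= k * t.
Proof.
move=> [perm_m _] m_gt0 t_gt0; rewrite -!mem_block // => /(map_f C').
by rewrite (perm_mem perm_m).
Qed.

Lemma paint_out k m t C C' p : paint k m t C C' -> 0 < m ->
  ~~ (k * m.-1 < p <= k * m) -> C' p = C p.
Proof. by move=> [_ outm] m_gt0; rewrite -mem_block // => /outm. Qed.

Lemma paint_uniq k m t C C' x s : paint k m t C C' -> 0 < m ->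
  k * m.-1 < x -> x + s <= (k * m).+1 -> uniq [seq C' p | p <- iota x s].
Proof.
move=> [perm_m _] m_gt0 ltx lexs.
have um : uniq [seq C' p | p <- block k m] by rewrite (perm_uniq perm_m) iota_uniq.
have leq_m : k * m = k * m.-1 + k by rewrite -mulnSr prednK.
apply: subseq_uniq um; apply: map_subseq.
(* The run is a contiguous piece of the block, whose colors are distinct. *)
have -> : block k m = iota (k * m.-1).+1 (x - (k * m.-1).+1)
    ++ iota x s ++ iota (x + s) ((k * m).+1 - (x + s)).
  rewrite /block -iotaD -[x in iota x (s + _)](subnKC ltx) -iotaD.
  by congr iota; lia.
exact: subseq_trans (prefix_subseq _ _) (suffix_subseq _ _).
Qed.

Lemma color_run_out k a b t C C' : color_run k a b t C C' -> 0 < a ->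
  forall p, ~~ (k * a.-1 < p <= k * b) -> C' p = C p.
Proof.
elim=> // {}a {}b {}t {}C C1 C2 C3 leab paint1 _ IHl _ IHr a_gt0 p pout.
set m := (a + b) %/ 2 in paint1 IHl IHr.
have [leam lemb] : a <= m /\ m <= b by lia.
have : k * a.-1 <= k * m.-1 /\ k * m.-1 <= k * m /\ k * m <= k * b.
  by rewrite !leq_mul2l; lia.
move=> bds.
rewrite IHr ?IHl //=; try lia.
by apply: (paint_out paint1); lia.
Qed.

(** [e] bounds the recursion depth: when fewer than [2 ^ e.+1] blocks remain, each side of the
    median has fewer than [2 ^ e]. *)
Lemma color_run_color e k a b t C C' : color_run k a b t C C' ->
  0 < a -> 0 < t -> b.+1 - a < 2 ^ e ->
  forall p, k * a.-1 < p <= k * b -> k * t.-1 < C' p <= k * (t.-1 + e).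
Proof.
move=> run; elim: run e => [{}a {}b {}t {}C ltba | {}a {}b {}t {}C C1 C2 C3].
  move=> e a_gt0 _ _ p pin.
  have leba : k * b <= k * a.-1 by apply: leq_mul => //; lia.
  by lia.
move=> leab paint1 runl IHl runr IHr [|e] a_gt0 t_gt0; first lia.
rewrite expnS => lte p pin.
set m := (a + b) %/ 2 in paint1 runl IHl runr IHr.
have [leam lemb] : a <= m /\ m <= b by lia.
have bds : k * a.-1 <= k * m.-1 /\ k * m.-1 <= k * m /\ k * m <= k * b.
  by rewrite !leq_mul2l; lia.
have bdt : k * t.-1 <= k * t /\ k * t <= k * (t.-1 + e.+1).
  by rewrite !leq_mul2l; lia.
have m_gt0 : 0 < m by lia.
have Et : t.+1.-1 + e = t.-1 + e.+1 by lia.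
have [ltmp | lepm] := ltnP (k * m) p.
  have := IHr e isT isT _ p; rewrite Et /=; lia.
rewrite (color_run_out runr) //=; last lia.
have [ltmp | lepm'] := ltnP (k * m.-1) p.
  rewrite (color_run_out runl) //=; last lia.
  have pm : k * m.-1 < p <= k * m by lia.
  by have := paint_color paint1 m_gt0 t_gt0 pm; lia.
have := IHl e a_gt0 isT _ p; rewrite Et /=; lia.
Qed.

Lemma color_run_color_gt k a b t C C' p : color_run k a b t C C' ->
  0 < a -> 0 < t -> k * a.-1 < p <= k * b -> k * t.-1 < C' p.
Proof.
move=> run a_gt0 t_gt0 pin.
(* Only the lower bound on colors is wanted, so a crude depth will do. *)
have := ltn_expl (b.+1 - a) (isT : 1 < 2).
by case/(color_run_color run a_gt0 t_gt0)/(_ _ pin)/andP.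
Qed.

Lemma color_run_nb_singletons k a b t C C' : color_run k a b t C C' ->
  0 < a -> 0 < t ->
  forall x s, k * a.-1 < x -> x + s <= (k * b).+1 ->
  minn s k <= nb_singletons [seq C' p | p <- iota x s].
Proof.
elim=> [{}a {}b {}t {}C ltba | {}a {}b {}t {}C C1 C2 C3].
  move=> a_gt0 _ x s.
  (* On an empty range of blocks the bounds on [x] force [s = 0]. *)
  have leba : k * b <= k * a.-1 by apply: leq_mul => //; lia.
  by lia.
move=> leab paint1 runl IHl runr IHr a_gt0 t_gt0 x s ltx lexs.
set m := (a + b) %/ 2 in paint1 runl IHl runr IHr.
have [leam lemb] : a <= m /\ m <= b by lia.
have bds : k * a.-1 <= k * m.-1 /\ k * m.-1 <= k * m /\ k * m <= k * b.
  by rewrite !leq_mul2l; lia.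
have m_gt0 : 0 < m by lia.
have Ekm : k * m = k * m.-1 + k by rewrite -mulnSr prednK.
have left y r : k * a.-1 < y -> y + r <= (k * m.-1).+1 ->
    minn r k <= nb_singletons [seq C3 p | p <- iota y r].
  move=> lty leyr; have -> : map C3 (iota y r) = map C2 (iota y r).
    apply/eq_in_map => p; rewrite mem_iota => pin.
    by rewrite (color_run_out runr) //=; lia.
  exact: IHl.
have right y r : k * m < y -> y + r <= (k * b).+1 ->
    minn r k <= nb_singletons [seq C3 p | p <- iota y r].
  exact: IHr.
have mid p : k * m.-1 < p <= k * m -> C3 p = C1 p.
  by move=> pin; rewrite (color_run_out runr) ?(color_run_out runl) //=; lia.
have out p : k * a.-1 < p <= k * b -> ~~ (k * m.-1 < p <= k * m) ->
    k * t < C3 p.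
  move=> pin pout; have [ltmp | lepm] := ltnP (k * m) p.
    have pr : k * m.+1.-1 < p <= k * b by rewrite /=; lia.
    exact: (color_run_color_gt runr isT isT pr).
  rewrite (color_run_out runr) //=; last lia.
  have pl : k * a.-1 < p <= k * m.-1 by lia.
  exact: (color_run_color_gt runl a_gt0 isT pl).
(* [r], [u], [v] are the numbers of points before, inside and after the median block; truncated
   subtraction gives 0 for a missing part. *)
pose r := minn s ((k * m.-1).+1 - x).
pose u := minn (s - r) ((k * m).+1 - (x + r)).
pose v := s - r - u.
have -> : iota x s = iota x r ++ iota (x + r) u ++ iota (x + r + u) v.
  by rewrite -!iotaD; congr iota; lia.
set L := iota x r; set M := iota _ u; set R := iota _ v.
rewrite !map_cat (perm_nb_singletons (permEl (perm_catCA _ _ _))).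
have EM : map C3 M = map C1 M.
  by apply/eq_in_map => p; rewrite mem_iota => pin; apply: mid; lia.
have nbM : nb_singletons (map C3 M) = u.
  (* If [u = 0], the start [x + r] may lie outside the block, where [paint_uniq] does not apply. *)
  case: (posnP u) => [u0 | u_gt0]; first by rewrite /M u0.
  by rewrite EM nb_singletons_uniq ?size_map ?size_iota // (paint_uniq paint1) //; lia.
(* The threshold [k * t] separates the colors: those of [M] are at most [k * t], those of [L] and
   [R] exceed it. *)
rewrite nb_singletons_cat ?nbM; last first.
  apply/hasPn => c; rewrite -map_cat => /mapP [p pLR ->] /=.
  rewrite EM; apply/mapP => -[q]; rewrite mem_iota => qM E.
  have qm : k * m.-1 < q <= k * m by lia.
  have := out p; rewrite E; have := paint_color paint1 m_gt0 t_gt0 qm.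
  by move: pLR; rewrite mem_cat !mem_iota; lia.
(* A run with points on both sides of the median block contains all [k] of its points. *)
have [-> | [r0 | v0]] : u = k \/ r = 0 \/ v = 0 by lia.
- lia.
- rewrite /L r0 /=; case: (posnP v) => [v0 | v_gt0]; first lia.
  have := right (x + r + u) v; rewrite -/R; lia.
- rewrite /R v0 /= cats0; case: (posnP r) => [r0 | r_gt0]; first lia.
  have := left x r; rewrite -/L; lia.
Qed.

(** Passes from ordinals to points numbered from 1; equality up to order is enough, as
    [nb_singletons] is invariant under permutation. *)
Lemma perm_map_succ_interval n (i j : 'I_n) :
  perm_eq [seq v.+1 | v : 'I_n in [set v : 'I_n | i <= v <= j]]
    (iota i.+1 (j.+1 - i)).
Proof.
apply: uniq_perm => [||p]; [|exact: iota_uniq|].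
  by rewrite map_inj_uniq ?enum_uniq // => v w /succn_inj /val_inj.
rewrite mem_iota; apply/mapP/idP => [[v] | pin].
  by rewrite mem_enum inE => vin ->; lia.
have ltp : p.-1 < n by have := ltn_ord j; lia.
by exists (Ordinal ltp); rewrite ?mem_enum ?inE /=; lia.
Qed.

Theorem lemma6 (k n : nat) (C0 C : nat -> nat) :
  1 <= k -> 1 <= n ->
  color_run k 1 (ceil_div n k) 1 C0 C ->
  (forall I : {set 'I_n}, I \in interval_hypergraph n ->
     scf_colored k (fun v : 'I_n => C v.+1) I) /\
  size (used_colors (fun v : 'I_(ceil_div n k * k) => C v.+1)
          [set: 'I_(ceil_div n k * k)])
    <= k * (trunc_log 2 (ceil_div n k) + 1).
Proof.
move=> k_gt0 n_gt0 run; set h := ceil_div n k in run *.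
split=> [I | ].
  rewrite inE => /existsP [i /existsP [j /andP [leij /eqP ->]]].
  have lenh : n <= k * h.
    have := divn_eq (n + k.-1) k; have := ltn_pmod (n + k.-1) k_gt0.
    by rewrite /h /ceil_div; lia.
  apply: scf_colored_nb_singletons.
  have /(perm_map C) := perm_map_succ_interval i j; rewrite -map_comp => permI.
  rewrite (perm_nb_singletons permI) cardE.
  rewrite -(size_map (C \o (fun v : 'I_n => v.+1))) (perm_size permI).
  rewrite size_map size_iota.
  apply: (color_run_nb_singletons run) => //; first by rewrite muln0.
  have := ltn_ord j; lia.
(* The distinct colors, those of the added points included, all lie in an initial segment of the
   positive integers. *)
rewrite -[X in _ <= X](size_iota 1); apply: uniq_leq_size; first exact: undup_uniq.
move=> c; rewrite mem_undup => /mapP [v _ ->].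
have := ltn_ord v; rewrite [X in _ < X]mulnC => ltv.
(* The depth for [h] blocks is the least [e] with [h < 2 ^ e]. *)
have lth : h.+1 - 1 < 2 ^ (trunc_log 2 h).+1 by rewrite subn1 trunc_log_ltn.
have /(_ v.+1) := color_run_color run isT isT lth.
by rewrite mem_iota muln0; lia.
Qed.
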